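(* Let $C_m$ be the cyclic group of order $m$, let $V$ be a rational FPF representation of $C_m$ of dimension $n=\dim_{\mathbb{Q}}V$, let $L\subset V$ be a $C_m$-invariant full-rank lattice, and consider the induced FPF $C_m$-action on the $n$-dimensional torus $V_{\mathbb{C}}/L$. Let $F$ be the set of non-free points, i.e. the points of $V_{\mathbb{C}}/L$ with nontrivial stabilizer. Then the number of non-free points is \[|F| =1-\omega(m)+ \sum_{p \mid m} p^{\frac{n}{p-1}},\] where $p$ ranges over the distinct prime divisors of $m$, and $\omega(m)$ denotes the number of distinct prime divisors of $m$.
   Context: A rational FPF (fixed-point-free) representation of a finite group $G$ is a finite-dimensional $\mathbb{Q}$-vector space $V$ with a linear $G$-action such that $\det(g-\mathrm{id}\mid V)\neq 0$ for every non-identity $g\in G$. A $G$-invariant full-rank lattice $L\subset V$ is a $G$-stable free $\mathbb{Z}$-submodule spanned by a $\mathbb{Q}$-basis of $V$. Put $V_{\mathbb{C}}=V\otimes_{\mathbb{Q}}\mathbb{C}$; the action of $G$ extends $\mathbb{C}$-linearly to $V_{\mathbb{C}}$ and induces an action on the torus $V_{\mathbb{C}}/L\cong(\mathbb{C}/\mathbb{Z})^n$ by $g\cdot[x]=[gx]$, called an FPF $G$-action on the torus.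
   Formalization: The case m = 1 is excluded (m > 1 is assumed): for the trivial group no point has a nontrivial stabilizer, so |F| = 0, while the formula would give 1. *)

(* Defs.v *)
From HB Require Import structures.
From mathcomp Require Import all_boot all_order all_algebra.
From mathcomp Require Import all_fingroup all_solvable mxrepresentation.
From mathcomp Require Import boolp classical_sets functions cardinality finmap.
From mathcomp Require Import reals exp complex.

Set Implicit Arguments.
Unset Strict Implicit.
Unset Printing Implicit Defensive.

Import Order.TTheory GRing.Theory Num.Theory.
Local Open Scope classical_set_scope.
Local Open Scope ring_scope.
Local Open Scope quotient_scope.

(* As everywhere in MathComp's representation theory, V is the space of row   *)
(* vectors 'rV[rat]_n and g \in G acts on it by v |-> v *m rG g. This is a    *)
(* right action, which for abelian G is the same thing as a left action.      *)
Definition fpf_repr (gT : finGroupType) (G : {group gT}) (n : nat)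
    (rG : mx_representation rat G n) : Prop :=
  forall g, g \in G -> g != 1%g -> \det (rG g - 1%:M) != 0.

Definition full_lattice (n : nat) (L : set 'rV[rat]_n) : Prop :=
  exists2 e : n.-tuple 'rV[rat]_n, basis_of fullv e &
    L = [set v | exists z : 'I_n -> int, v = \sum_(i < n) tnth e i *~ z i].

Record invariant_lattice (gT : finGroupType) (G : {group gT}) (n : nat)
    (rG : mx_representation rat G n) := InvariantLattice {
  lattice_set :> set 'rV[rat]_n;
  lattice_full : full_lattice lattice_set;
  lattice_stable : forall g v,
    g \in G -> lattice_set v -> lattice_set (v *m rG g) }.

Section Torus.
Variables (R : realType) (gT : finGroupType) (G : {group gT}) (n : nat).
Variables (rG : mx_representation rat G n) (L : invariant_lattice rG).

(* The image of L under the inclusion V -> V_C = 'rV[R[i]]_n. *)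
Definition lattice_C : {pred 'rV[R[i]]_n} :=
  fun x => `[< exists2 v, lattice_set L v & x = map_mx ratr v >].

Lemma lattice_C_zmod_closed : zmod_closed lattice_C.
Proof.
have [e _ LE] := lattice_full L; split.
  apply/asboolP; exists 0; last by rewrite map_mx0.
  by rewrite LE; exists (fun=> 0); rewrite big1.
move=> x y /asboolP[u Lu ->] /asboolP[v Lv ->]; apply/asboolP.
exists (u - v); last by rewrite map_mxB.
move: Lu Lv; rewrite LE => -[z ->] [t ->].
exists (fun i => z i - t i).
by rewrite -sumrB; apply: eq_bigr => i _; rewrite mulrzBr.
Qed.

HB.instance Definition _ :=
  GRing.isZmodClosed.Build 'rV[R[i]]_n lattice_C lattice_C_zmod_closed.

Definition torus := @Quotient.quot 'rV[R[i]]_n lattice_C.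

HB.instance Definition _ := GRing.Zmodule.on torus.
HB.instance Definition _ := Quotient.on torus.

Definition repr_C : mx_representation R[i] G n :=
  map_repr (@ratr R[i]) rG.

(* Independent of the chosen representative for g \in G: see torus_act_pi. *)
Definition torus_act (x : torus) (g : gT) : torus :=
  \pi_torus (generic_quotient.repr x *m repr_C g).

Lemma torus_eqP (x y : 'rV[R[i]]_n) :
  reflect (\pi_torus x = \pi_torus y) (x - y \in lattice_C).
Proof. by rewrite Quotient.idealrBE; apply: eqP. Qed.

Lemma torus_act_pi (x : 'rV[R[i]]_n) (g : gT) : g \in G ->
  torus_act (\pi_torus x) g = \pi_torus (x *m repr_C g).
Proof.
move=> Gg; apply/torus_eqP; rewrite -mulmxBl.
have /torus_eqP/asboolP[v Lv ->] :
  \pi_torus (generic_quotient.repr (\pi_torus x)) = \pi_torus x by rewrite reprK.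
apply/asboolP; exists (v *m rG g); first exact: lattice_stable.
by rewrite map_mxM.
Qed.

Lemma torus_act1 (x : torus) : torus_act x 1%g = x.
Proof. by rewrite /torus_act repr_mx1 mulmx1 reprK. Qed.

Lemma torus_actM (x : torus) (g h : gT) : g \in G -> h \in G ->
  torus_act x (g * h)%g = torus_act (torus_act x g) h.
Proof.
move=> Gg Gh; rewrite [torus_act x g]/torus_act torus_act_pi// -mulmxA.
by rewrite -repr_mxM.
Qed.

Definition torus_stab (x : torus) : {set gT} :=
  [set g in G | torus_act x g == x].

Definition nonfree_points : set torus := [set x | torus_stab x != 1%g].

End Torus.

Arguments nonfree_points R {gT G n rG} L _.

(* Main.v *)
(** Let [h] have prime order [p], and let [F] be its fixed points on the torus
    [T]. Since [1 - h] is invertible, [1 + h + ... + h ^ (p - 1) = 0], hence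
    [(1 - h) (1 - h ^ 2) ... (1 - h ^ (p - 1)) = p]. Each factor is a surjective
    endomorphism of [T] whose kernel is again [F], as [h ^ j] generates the same
    group as [h]. Thus [|F| ^ (p - 1)] is the number [p ^ n] of [p]-torsion points
    of [T]. Moreover [F] lies in the [p]-torsion, so that the fixed points for
    distinct primes meet only in [0]; and in a cyclic group a nontrivial
    stabilizer contains the unique subgroup of order [p] for some [p]. *)
Require Import Defs.
From mathcomp Require Import all_boot all_order all_algebra.
From mathcomp Require Import all_fingroup all_solvable all_field mxrepresentation.
From mathcomp Require Import boolp classical_sets functions cardinality finmap.
From mathcomp Require Import reals exp complex.
From mathcomp Require Import zify.
Import Order.TTheory GRing.Theory Num.Theory.
Local Open Scope ring_scope.
Local Open Scope classical_set_scope.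

Set Implicit Arguments.
Unset Strict Implicit.

(** * Roots of unity and the product of the factors [1 - A ^+ j] *)

Lemma prod_XsubC_prim_root (F : fieldType) (p : nat) (z : F) :
  p.-primitive_root z ->
  \prod_(1 <= j < p) ('X - (z ^+ j)%:P) = \sum_(i < p) 'X^i :> {poly F}.
Proof.
move=> pz; have XD1_neq0 : 'X - 1 != 0 :> {poly F} by rewrite polyXsubC_eq0.
apply: (mulfI XD1_neq0).
have <- := subrX1 ('X : {poly F}) p.
by rewrite -(factor_Xn_sub_1 pz) [RHS]big_ltn ?(prim_order_gt0 pz)// expr0.
Qed.

Lemma prod_sub_expr_prim_root (F : fieldType) (p : nat) (z : F) :
  p.-primitive_root z -> \prod_(1 <= j < p) (1 - z ^+ j) = p%:R.
Proof.
move=> pz.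
have := congr1 (horner^~ 1) (prod_XsubC_prim_root pz); rewrite horner_prod horner_sum.
under eq_bigr do rewrite hornerXsubC.
under [X in _ = X -> _]eq_bigr do rewrite hornerXn expr1n.
by rewrite sumr_const card_ord.
Qed.

(** Divisibility may be tested over [algC], where the left side splits with the simple roots
    [z ^+ i], [0 < i < p]. Each of these is again a primitive p-th root of unity, so the product
    takes the value p there. A divisibility over the rationals can then be evaluated at a rational
    matrix. *)
Lemma dvdp_prod_sub_expX (p : nat) : prime p ->
  \sum_(i < p) 'X^i %| \prod_(1 <= j < p) (1 - 'X^j : {poly rat}) - p%:R%:P.
Proof.
move=> p_pr; have [z pz] := C_prim_root_exists (prime_gt0 p_pr).
rewrite -(dvdp_map (ratr : {rmorphism rat -> algC})).
rewrite rmorph_sum rmorphB rmorph_prod /= map_polyC /= rmorph_nat.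
under eq_bigr do rewrite map_polyXn.
under [X in _ %| X - _]eq_bigr do rewrite rmorphB rmorph1 /= map_polyXn.
rewrite -(prod_XsubC_prim_root pz).
rewrite -(big_map (fun j => z ^+ j) xpredT (fun x => 'X - x%:P)).
apply: uniq_roots_dvdp; last first.
  rewrite uniq_rootsE map_inj_in_uniq ?iota_uniq// => i j.
  rewrite !mem_index_iota => /andP[_ ip] /andP[_ jp] /eqP.
  by rewrite (eq_prim_root_expr pz) !modn_small// => /eqP.
apply/allP => _ /mapP[i + ->]; rewrite mem_index_iota => /andP[i_gt0 ip].
have pzi : p.-primitive_root (z ^+ i).
  by rewrite (prim_root_exp_coprime i pz) coprime_sym prime_coprime// gtnNdvd.
rewrite /root !hornerE horner_prod -(prod_sub_expr_prim_root pzi) subr_eq0.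
by apply/eqP/eq_bigr => j _; rewrite !hornerE.
Qed.

Lemma prod_sub_exprmx (p n : nat) (A : 'M[rat]_n) : prime p ->
  \sum_(i < p) A ^+ i = 0 -> \prod_(1 <= j < p) (1 - A ^+ j) = p%:R.
Proof.
(* In size 0 all matrices coincide; polynomials are evaluated at matrices of positive size. *)
case: n A => [|n] A p_pr A0; first by rewrite [LHS]flatmx0 [RHS]flatmx0.
have /(congr1 (horner_mx A)) := divpK (dvdp_prod_sub_expX p_pr).
have AX j : horner_mx A 'X^j = A ^+ j by rewrite rmorphXn /= horner_mx_X.
rewrite rmorphM rmorph_sum rmorphB rmorph_prod /=.
rewrite [X in _ * X](eq_bigr (fun i : 'I_p => A ^+ i)) => [|i _]; last exact: AX.
rewrite [X in _ = X - _](eq_bigr (fun j => 1 - A ^+ j)) => [|j _]; last first.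
  by rewrite rmorphB rmorph1 /= AX.
rewrite A0 mulr0 horner_mx_C => /esym/eqP; rewrite subr_eq0 => /eqP->.
by rewrite raddfMn.
Qed.

(** * Counting preimages under a surjective additive map *)

Lemma card_preimage_morphism (T U : zmodType) (f : T -> U) (A : set U) :
    {morph f : x y / x - y} -> (forall y, exists x, f x = y) ->
    finite_set (f @^-1` [set 0]) -> finite_set A ->
  finite_set (f @^-1` A) /\
  #|` fset_set (f @^-1` A)| =
    (#|` fset_set (f @^-1` [set 0%R])| * #|` fset_set A|)%N.
Proof.
move=> fB /choice[s sK] fin_ker finA.
have f0 : f 0 = 0 by rewrite -[X in f X](subrr 0) fB subrr.
have fN x : f (- x) = - f x by rewrite -sub0r fB f0 sub0r.
have fD x y : f (x + y) = f x + f y by rewrite -[y in LHS]opprK fB fN opprK.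
(* As [s] is a section of [f], the map from (k, a) to [k + s a] is a bijection from the kernel times
   [A] onto the preimage of [A]. *)
pose r := [seq k + s a | k <- fset_set (f @^-1` [set 0]), a <- fset_set A].
have mem_r (x : T) : x \in r <-> A (f x).
  split=> [/allpairsP[[k a] /= []]|Afx].
    by rewrite !in_fset_set// => /set_mem/= k0 /set_mem Aa ->; rewrite fD sK k0 add0r.
  apply/allpairsP; exists (x - s (f x), f x); rewrite /= !in_fset_set//.
  by split; rewrite ?subrK//; apply/mem_set => //=; rewrite fB sK subrr.
have fin_r : finite_set (f @^-1` A).
  by apply: sub_finite_set (finite_seq r) => x /mem_r.
split=> //; rewrite -(size_allpairs (fun k a => k + s a)).
apply/perm_size/uniq_perm => [|| x]; rewrite ?fset_uniq ?in_fset_set//; last first.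
  by apply/idP/idP => [/set_mem/mem_r//|/mem_r/mem_set].
apply: allpairs_uniq => [||[k a] [l b]]; rewrite ?fset_uniq//.
move=> /allpairsP[[? ?] /= []] + _ [-> _].
rewrite in_fset_set// => /set_mem/= k0 /allpairsP[[? ?] /= []] + _ [-> _].
rewrite in_fset_set// => /set_mem/= l0.
move=> kl; have ab : a = b by have := congr1 f kl; rewrite !fD k0 l0 !add0r !sK.
by move: kl; rewrite ab => /addIr->.
Qed.

(** * Endomorphisms of the torus induced by rational matrices that preserve the lattice *)

Section Torus.
Local Open Scope quotient_scope.
Variables (R : realType) (gT : finGroupType) (G : {group gT}) (n : nat).
Variables (rG : mx_representation rat G n) (L : invariant_lattice rG).
Implicit Types (M N : 'M[rat]_n) (x y : torus R L).

Let ratrC : {rmorphism rat -> R[i]} := @ratr R[i].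

Lemma latticeB u v : lattice_set L u -> lattice_set L v -> lattice_set L (u - v).
Proof.
have [e _ ->] := lattice_full L => -[z ->] [t ->].
by exists (fun i => z i - t i); rewrite -sumrB; apply: eq_bigr => i _; rewrite mulrzBr.
Qed.

Lemma mem_lattice_C (v : 'rV[rat]_n) : map_mx ratrC v \in lattice_C L -> lattice_set L v.
Proof. by move=> /asboolP[w Lw] /map_mx_inj->. Qed.

Lemma pi_torusB (a b : 'rV[R[i]]_n) :
  \pi_(torus R L) (a - b) = \pi_(torus R L) a - \pi_(torus R L) b.
Proof. exact: raddfB. Qed.

Lemma pi_torusMn (a : 'rV[R[i]]_n) p :
  \pi_(torus R L) (a *+ p) = \pi_(torus R L) a *+ p.
Proof. by rewrite raddfMn. Qed.

Lemma pi_torus_eq0 (a : 'rV[R[i]]_n) :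
  \pi_(torus R L) a = 0 <-> a \in lattice_C L.
Proof.
have pi0 : \pi_(torus R L) 0 = 0 by rewrite raddf0.
by rewrite -pi0; split=> [/torus_eqP|aL]; [|apply/torus_eqP]; rewrite subr0.
Qed.

Definition stabilizes_lattice M := forall v, lattice_set L v -> lattice_set L (v *m M).

(** Total in [M], through a chosen representative of [x]; once [M] stabilizes the lattice, the
    choice does not matter, by [torus_mulmx_pi]. Besides group elements this covers the differences
    [1 - rG g] and their products. *)
Definition torus_mulmx M x : torus R L :=
  \pi_(torus R L) (generic_quotient.repr x *m map_mx ratrC M).

Lemma torus_mulmx_pi M (a : 'rV[R[i]]_n) : stabilizes_lattice M ->
  torus_mulmx M (\pi_(torus R L) a) = \pi_(torus R L) (a *m map_mx ratrC M).
Proof.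
move=> stM; apply/torus_eqP; rewrite -mulmxBl.
have /torus_eqP/asboolP[v Lv ->] :
  \pi_(torus R L) (generic_quotient.repr (\pi_(torus R L) a)) = \pi_(torus R L) a.
  by rewrite reprK.
by apply/asboolP; exists (v *m M); [exact: stM | rewrite map_mxM].
Qed.

Lemma torus_mulmxB M : stabilizes_lattice M -> {morph torus_mulmx M : x y / x - y}.
Proof.
move=> stM x y; rewrite -[x]reprK -[y]reprK -pi_torusB !torus_mulmx_pi//.
by rewrite mulmxBl pi_torusB.
Qed.

(** A preimage is found by lifting [y] to the complex vector space and applying the inverse matrix
    there; that inverse need not stabilize the lattice. *)
Lemma torus_mulmx_surj M : stabilizes_lattice M -> \det M != 0 ->
  forall y, exists x, torus_mulmx M x = y.
Proof.
move=> stM detM y; rewrite -[y]reprK; set a := generic_quotient.repr y.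
exists (\pi_(torus R L) (a *m invmx (map_mx ratrC M))).
by rewrite torus_mulmx_pi// mulmxKV// map_unitmx unitmxE unitfE.
Qed.

Lemma torus_mulmxM M N x : stabilizes_lattice M -> stabilizes_lattice N ->
  torus_mulmx (M *m N) x = torus_mulmx N (torus_mulmx M x).
Proof.
move=> stM stN; rewrite -[x]reprK (torus_mulmx_pi _ stM) !torus_mulmx_pi//.
  by rewrite map_mxM mulmxA.
by move=> v Lv; rewrite mulmxA; apply/stN/stM.
Qed.

Lemma torus_mulmxBl M N x : torus_mulmx (M - N) x = torus_mulmx M x - torus_mulmx N x.
Proof. by rewrite /torus_mulmx map_mxB mulmxBr pi_torusB. Qed.

Lemma torus_mulmx1 x : torus_mulmx 1 x = x.
Proof. by rewrite /torus_mulmx map_mx1 mulmx1 reprK. Qed.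

Lemma torus_mulmx_nat p x : torus_mulmx p%:R x = x *+ p.
Proof.
rewrite -[in RHS](reprK x) -pi_torusMn /torus_mulmx.
by rewrite (raddfMn (map_mx ratrC)) /= map_mx1 (raddfMn (mulmx _)) /= mulmx1.
Qed.

(** Row vectors meet [M] first, so the kernel of the product is the preimage of the kernel of [N]
    under the surjection given by [M]. *)
Lemma card_ker_torus_mulmx M N :
    stabilizes_lattice M -> stabilizes_lattice N -> \det M != 0 ->
    finite_set (torus_mulmx M @^-1` [set 0]) ->
    finite_set (torus_mulmx N @^-1` [set 0]) ->
  finite_set (torus_mulmx (M *m N) @^-1` [set 0]) /\
  #|` fset_set (torus_mulmx (M *m N) @^-1` [set 0])| =
    (#|` fset_set (torus_mulmx M @^-1` [set 0%R])| *
     #|` fset_set (torus_mulmx N @^-1` [set 0%R])|)%N.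
Proof.
move=> stM stN detM finM finN.
have -> : torus_mulmx (M *m N) @^-1` [set 0] =
    torus_mulmx M @^-1` (torus_mulmx N @^-1` [set 0]).
  by apply/seteqP; split=> x /=; rewrite torus_mulmxM.
exact: card_preimage_morphism (torus_mulmxB stM) (torus_mulmx_surj stM detM) _ _.
Qed.

(** * Torsion points of the torus *)

Lemma torus_torsion p : (0 < p)%N ->
  finite_set [set x : torus R L | x *+ p = 0] /\
  #|` fset_set [set x : torus R L | x *+ p = 0]| = (p ^ n)%N.
Proof.
move=> p_gt0; have [e e_basis LE] := lattice_full L.
have p_neq0 : p%:R != 0 :> rat by rewrite pnatr_eq0 -lt0n.
have e_free := basis_free e_basis.
(* In coordinates along a lattice basis, the p-torsion points are those with coordinates [c i / p],
   where the digits [c i] run over 0, ..., p - 1. So [f] enumerates them without repetition. *)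
pose v (c : {ffun 'I_n -> 'I_p}) := \sum_i (c i)%:R / p%:R *: tnth e i.
pose f c := \pi_(torus R L) (map_mx ratrC (v c)).
have f_inj : injective f.
  move=> c d /torus_eqP; rewrite -map_mxB => /mem_lattice_C; rewrite LE => -[z].
  rewrite -sumrB => vE; apply/ffunP => i; apply/val_inj.
  have /(congr1 (coord e i)) : \sum_(j < n) (((c j)%:R - (d j)%:R) / p%:R) *: e`_j =
      \sum_(j < n) (z j)%:~R *: e`_j :> 'rV[rat]_n.
    transitivity (\sum_(j < n) tnth e j *~ z j); first rewrite -vE.
      by apply: eq_bigr => j _; rewrite -scalerBl -mulrBl (tnth_nth 0).
    by apply: eq_bigr => j _; rewrite scaler_int (tnth_nth 0).
  rewrite !coord_sum_free// => /(canRL (mulfVK p_neq0))/eqP.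
  rewrite subr_eq -[(c i)%:R]/((c i)%:Z%:~R) -[(d i)%:R]/((d i)%:Z%:~R).
  rewrite -[p%:R]/(p%:Z%:~R) -intrM -intrD eqr_int => /eqP cE.
  (* Here [c i = z i * p + d i] with both digits below p, so reduction modulo p identifies them. *)
  have := congr1 (modz^~ p) cE; rewrite modzMDl !modz_small ?ltz_nat ?ltn_ord//.
  by case.
have f_torsion c : f c *+ p = 0.
  rewrite -pi_torusMn; apply/pi_torus_eq0/asboolP; exists (v c *+ p).
    rewrite LE; exists (fun i => (c i)%:Z); rewrite -sumrMnl; apply: eq_bigr => i _.
    by rewrite -scaler_nat scalerA mulrCA divff// mulr1 scaler_nat.
  by rewrite raddfMn.
have f_surj x : x *+ p = 0 -> exists c, f c = x.
  rewrite -[x]reprK; set a := generic_quotient.repr x; rewrite -pi_torusMn.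
  move=> /pi_torus_eq0/asboolP[u]; rewrite LE => -[z ->] aE.
  have zP i : (`|z i %% p|%Z < p)%N.
    by rewrite -ltz_nat gez0_abs ?modz_ge0 ?ltz_pmod// -?lt0n// eqz_nat -lt0n.
  exists [ffun i => Ordinal (zP i)]; apply/torus_eqP.
  (* As [a *+ p] lies in the lattice, [a] is itself a rational vector, with coordinates
     [z i / p]. *)
  have {}aE : a = map_mx ratrC (p%:R^-1 *: \sum_i tnth e i *~ z i).
    rewrite map_mxZ -aE fmorphV rmorph_nat -[a *+ p]scaler_nat scalerK//.
    by rewrite pnatr_eq0 -lt0n.
  rewrite aE -map_mxB; apply/asboolP; eexists; last by [].
  (* Replacing [z i / p] by [(z i %% p) / p] changes the coordinate by minus the integer
     quotient. *)
  rewrite LE; exists (fun i => - (z i %/ p)%Z).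
  rewrite scaler_sumr -sumrB; apply: eq_bigr => i _; rewrite ffunE /=.
  rewrite -[in LHS]scaler_int scalerA -scalerBl -scaler_int; congr (_ *: _).
  have zE : (z i)%:~R = (z i %/ p)%Z%:~R * p%:R + (z i %% p)%Z%:~R :> rat.
    by rewrite {1}(divz_eq (z i) p) intrD intrM.
  rewrite -[(`|_|%N)%:R]/(`|_|%N%:Z%:~R) gez0_abs ?modz_ge0 ?eqz_nat -?lt0n// zE.
  by rewrite mulrC -mulrBr opprD addrCA subrr addr0 mulrN mulrC mulfK// intrN.
pose r := [seq f c | c : {ffun 'I_n -> 'I_p}].
have mem_r x : x \in r <-> x *+ p = 0.
  split=> [/mapP[c _ ->]|/f_surj[c <-]]; first exact: f_torsion.
  by apply/mapP; exists c; rewrite ?mem_enum.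
have fin_r : finite_set [set x : torus R L | x *+ p = 0].
  by apply: sub_finite_set (finite_seq r) => x /mem_r.
split=> //; transitivity (size r); last by rewrite size_map -cardE card_ffun !card_ord.
apply/perm_size/uniq_perm => [|| x]; rewrite ?fset_uniq ?in_fset_set//.
  by rewrite map_inj_uniq ?enum_uniq.
by apply/idP/idP => [/set_mem/mem_r//|/mem_r/mem_set].
Qed.

(** * Fixed points of group elements as kernels *)

Lemma stabilizes_lattice_mulmx M N : stabilizes_lattice M ->
  stabilizes_lattice N -> stabilizes_lattice (M *m N).
Proof. by move=> stM stN v Lv; rewrite mulmxA; apply/stN/stM. Qed.

Lemma stabilizes_lattice_1B g : g \in G -> stabilizes_lattice (1 - rG g).
Proof.
move=> Gg v Lv; rewrite mulmxBr mulmx1.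
by apply: latticeB => //; apply: lattice_stable.
Qed.

Lemma repr_mx_expr g j : g \in G -> rG (g ^+ j)%g = rG g ^+ j.
Proof.
move=> Gg; elim: j => [|j IHj]; first by rewrite expg0 repr_mx1.
by rewrite expgS repr_mxM ?groupX// IHj exprS.
Qed.

Definition fixed_points g : set (torus R L) := [set x | torus_act x g = x].

Lemma fixed_pointsE g : fixed_points g = torus_mulmx (1 - rG g) @^-1` [set 0].
Proof.
apply/seteqP; split=> x /=; rewrite torus_mulmxBl torus_mulmx1.
  by move=> {1}<-; rewrite subrr.
by move/eqP; rewrite subr_eq0 => /eqP/esym.
Qed.

Lemma fixed_points_expg g j : g \in G -> fixed_points g `<=` fixed_points (g ^+ j)%g.
Proof.
move=> Gg x xg; elim: j => [|j IHj]; rewrite /fixed_points/= ?torus_act1//.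
by rewrite expgS torus_actM ?groupX// xg IHj.
Qed.

Lemma fixed_points_cycle g h : g \in G -> h \in <[g]>%g ->
  fixed_points g `<=` fixed_points h.
Proof. by move=> Gg /cycleP[j ->]; apply: fixed_points_expg. Qed.

(** * Fixed points of an element of prime order *)

Section PrimeOrder.
Variables (p : nat) (h : gT).
Hypotheses (p_pr : prime p) (Gh : h \in G) (h_order : #[h]%g = p).
Hypothesis fpf : fpf_repr rG.

Lemma det_1B_neq0 g : g \in G -> g != 1%g -> \det (1 - rG g) != 0.
Proof.
move=> Gg g1; rewrite -opprB -scaleN1r detZ mulf_neq0 ?fpf//.
by rewrite expf_neq0// oppr_eq0 oner_eq0.
Qed.

Lemma expg_prime_order_neq1 j : (0 < j < p)%N -> (h ^+ j != 1)%g.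
Proof.
by case/andP=> j_gt0 jp; rewrite -order_dvdn h_order gtnNdvd.
Qed.

Lemma prod_1B_repr : \prod_(1 <= j < p) (1 - rG (h ^+ j)%g) = p%:R.
Proof.
under eq_bigr do rewrite repr_mx_expr//.
apply: prod_sub_exprmx => //.
have h1 : h != 1%g.
  by apply: (expg_prime_order_neq1 (j := 1)); rewrite prime_gt1.
(* The invertible factor [rG h - 1] cancels from its product with the geometric sum, which is
   [rG h ^+ p - 1 = 0]. *)
have U : rG h - 1%:M \in unitmx by rewrite unitmxE unitfE fpf.
rewrite -[LHS](mulKmx U).
have -> : (rG h - 1%:M) *m \sum_(i < p) rG h ^+ i = rG h ^+ p - 1.
  by rewrite subrX1.
by rewrite -repr_mx_expr// -h_order expg_order repr_mx1 subrr mulmx0.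
Qed.

(** Since j is prime to p, [h] is in turn a power of [h ^+ j]. *)
Lemma fixed_points_prime_exp j : (0 < j < p)%N ->
  fixed_points (h ^+ j)%g = fixed_points h.
Proof.
case/andP=> j_gt0 jp; apply/seteqP; split; last exact: fixed_points_expg.
apply: fixed_points_cycle; first exact: groupX.
have /eqP <- : generator <[h]> (h ^+ j)%g; last exact: cycle_id.
by rewrite generator_coprime h_order prime_coprime// gtnNdvd.
Qed.

(** An arbitrary list of exponents serves both for the initial partial products and for the product
    with its first factor removed. *)
Lemma stabilizes_lattice_prod (s : seq nat) :
  stabilizes_lattice (\prod_(j <- s) (1 - rG (h ^+ j)%g)).
Proof.
apply: (big_ind stabilizes_lattice) => [v Lv|M N|j _]; first by rewrite mulmx1.
  exact: stabilizes_lattice_mulmx.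
by apply: stabilizes_lattice_1B; rewrite groupX.
Qed.

(** Multiplication by p is the product of the [1 - rG (h ^+ j)], whose first factor, [j = 1],
    already kills the fixed points of [h]. *)
Lemma fixed_points_torsion : fixed_points h `<=` [set x | x *+ p = 0].
Proof.
rewrite fixed_pointsE => x /= xh.
rewrite -torus_mulmx_nat -prod_1B_repr big_ltn ?prime_gt1// expg1.
rewrite [torus_mulmx _ _]torus_mulmxM; last exact: stabilizes_lattice_prod.
  rewrite xh -(subrr (0 : torus R L)) torus_mulmxB ?subrr//.
  exact: stabilizes_lattice_prod.
exact: stabilizes_lattice_1B.
Qed.

Lemma finite_fixed_points : finite_set (fixed_points h).
Proof.
apply: sub_finite_set fixed_points_torsion _.
by have [] := torus_torsion (prime_gt0 p_pr).
Qed.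

Lemma card_fixed_points :
  (#|` fset_set (fixed_points h)| ^ p.-1 = p ^ n)%N.
Proof.
pose P k := \prod_(1 <= j < k.+1) (1 - rG (h ^+ j)%g).
have stP k : stabilizes_lattice (P k) by exact: stabilizes_lattice_prod.
(* Each new factor multiplies the size of the kernel by the number of fixed points of [h]. The bound
   [k < p] keeps every [h ^+ j] nontrivial, hence every factor invertible. *)
have kerP k : (k < p)%N -> [/\ \det (P k) != 0,
    finite_set (torus_mulmx (P k) @^-1` [set 0]) &
    #|` fset_set (torus_mulmx (P k) @^-1` [set 0%R])| =
      (#|` fset_set (fixed_points h)| ^ k)%N].
  elim: k => [|k IHk] kp.
    have -> : P 0%N = 1 by rewrite /P big_nil.
    have -> : torus_mulmx 1 @^-1` [set 0] = [set 0].
      by apply/seteqP; split=> x /=; rewrite torus_mulmx1.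
    by rewrite det1 oner_eq0 fset_set1 cardfs1.
  have [detP finP cardP] := IHk (ltnW kp).
  have k_range : (0 < k.+1 < p)%N by [].
  have Gk : (h ^+ k.+1)%g \in G by rewrite groupX.
  have PS : P k.+1 = P k *m (1 - rG (h ^+ k.+1)%g) by rewrite /P big_nat_recr.
  have kerS : torus_mulmx (1 - rG (h ^+ k.+1)%g) @^-1` [set 0] = fixed_points h.
    by rewrite -fixed_pointsE fixed_points_prime_exp.
  have [|fin_ker card_ker] := card_ker_torus_mulmx (stP k)
      (stabilizes_lattice_1B Gk) detP finP.
    by rewrite kerS; apply: finite_fixed_points.
  rewrite PS; split=> //; last by rewrite card_ker kerS cardP expnSr.
  by rewrite det_mulmx mulf_neq0// det_1B_neq0// expg_prime_order_neq1.
(* At [k = p.-1] the product is p, whose kernel is the p-torsion. *)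
have [_ <-] := torus_torsion (prime_gt0 p_pr).
have [|_ _ <-] := kerP p.-1; first by rewrite ltn_predL prime_gt0.
congr (#|` fset_set _|); rewrite /P prednK ?prime_gt0// prod_1B_repr.
by apply/seteqP; split=> x /=; rewrite torus_mulmx_nat.
Qed.

End PrimeOrder.

(** * Combination of the fixed points belonging to different primes *)

Lemma torsion_coprime p q x : coprime p q -> x *+ p = 0 -> x *+ q = 0 -> x = 0.
Proof.
move=> pq xp xq.
have [p0|p_gt0] := posnP p; first by move: pq xq; rewrite p0 /coprime gcd0n => /eqP->.
(* Bezout in the natural numbers: [1 + u * q = v * p]. *)
have [u _ /dvdnP[v]] := Bezoutl q p_gt0.
rewrite (eqP pq) => /(congr1 (GRing.natmul x)).
by rewrite mulrnDr mulnC mulrnA xq mul0rn mulnC mulrnA xp mul0rn addr0.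
Qed.

End Torus.

Arguments fixed_points R {gT G n rG} L g _.

(** A new set [A p] meets the union of the others only in [a], so it contributes one point less than
    its size. Having [size s] on the left avoids truncated subtraction, and the disjunct [x = a]
    makes the empty list a valid base case. *)
Lemma card_bouquet (T : choiceType) (a : T) (A : nat -> set T) (s : seq nat) :
    uniq s -> (forall p, p \in s -> finite_set (A p)) ->
    (forall p, p \in s -> A p a) ->
    (forall p q, p \in s -> q \in s -> p != q -> A p `&` A q `<=` [set a]) ->
  let U := [set x | x = a \/ exists2 p, p \in s & A p x] in
  finite_set U /\
  (#|` fset_set U| + size s = 1 + \sum_(p <- s) #|` fset_set (A p)|)%N.
Proof.
elim: s => [|p s IHs] /= us finA Aa A_disj.
  have -> : [set x | x = a \/ exists2 p : nat, p \in [::] & A p x] = [set a].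
    by apply/seteqP; split=> x /= => [[-> //|[]]//|->]; left.
  by split=> //; rewrite fset_set1 cardfs1 big_nil.
case/andP: us => ps us.
set V := [set x | _]; pose U := [set x | x = a \/ exists2 p, p \in s & A p x].
have [|||finU cardU] := IHs us.
- by move=> q qs; apply: finA; rewrite inE qs orbT.
- by move=> q qs; apply: Aa; rewrite inE qs orbT.
- by move=> q r qs rs; apply: A_disj; rewrite inE ?qs ?rs orbT.
have p_in : p \in p :: s by rewrite mem_head.
have VE : V = A p `|` U.
  apply/seteqP; split=> x /= => [[->|[q]]|[Apx|[->|[q qs Aqx]]]].
  - by left; apply: Aa.
  - by rewrite inE => /predU1P[->|qs] Aqx; [left|right; right; exists q].
  - by right; exists p.
  - by left.
  - by right; exists q; rewrite // inE qs orbT.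
have IE : A p `&` U = [set a].
  apply/seteqP; split=> x /= => [[Apx [//|[q qs Aqx]]]|->].
    apply: (A_disj p q) => //; first by rewrite inE qs orbT.
    by apply: contraNneq ps => ->.
  by split; [apply: Aa | left].
have finAp := finA p p_in.
split; first by rewrite VE finite_setU.
have := cardfsUI (fset_set (A p)) (fset_set U).
rewrite -fset_setU// -fset_setI// -VE IE fset_set1 cardfs1 big_cons.
move: cardU; rewrite -/U; lia.
Qed.

(** The d-th root is taken as a real power, so that divisibility of n by d need not be
    established. *)
Lemma natr_powR_root (R : realType) (N p d n : nat) : (0 < d)%N ->
  (N ^ d = p ^ n)%N -> N%:R = p%:R `^ (n%:R / d%:R) :> R.
Proof.
move=> d_gt0 /(congr1 (fun k => k%:R : R)); rewrite !natrX => Nd.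
rewrite powRrM powR_mulrn// -Nd -powR_mulrn// -powRrM divff ?powRr1//.
by rewrite pnatr_eq0 -lt0n.
Qed.

(* The non-free points for a cyclic group *)
Local Close Scope classical_set_scope.
Unset Implicit Arguments.
Set Strict Implicit.

(* For m = 1 every stabilizer is trivial while the right-hand side is 1. *)
Theorem theorem4p1 (R : realType) (gT : finGroupType) (G : {group gT})
    (m n : nat) (rG : mx_representation rat G n) (L : invariant_lattice rG) :
  cyclic G -> #|G| = m -> (1 < m)%N -> fpf_repr rG ->
  finite_set (nonfree_points R L) /\
  (#|` fset_set (nonfree_points R L)|)%:R =
    1 - (size (primes m))%:R
      + \sum_(p <- primes m) (p%:R `^ (n%:R / (p%:R - 1))) :> R.
Proof.
move=> cycG oG m_gt1 fpf; have [g defG] := cyclicP cycG.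
have og : #[g]%g = m by rewrite orderE -defG.
have m_gt0 := ltnW m_gt1.
have Gg : g \in G by rewrite defG cycle_id.
(* For p dividing m this generates the unique subgroup of order p. *)
pose h p := (g ^+ (m %/ p))%g.
have Gh p : h p \in G by rewrite groupX.
have oh p : p \in primes m -> #[h p]%g = p.
  rewrite mem_primes => /and3P[p_pr _ pm].
  by rewrite orderXdiv ?og ?dvdn_div// divnA// mulKn.
have prime_mem p : p \in primes m -> prime p by rewrite mem_primes => /andP[].
have fix0 g' : g' \in G -> fixed_points R L g' 0.
  move=> Gg'; rewrite fixed_pointsE /=.
  by apply/eqP; rewrite -(subrr 0) torus_mulmxB ?subrr//; apply: stabilizes_lattice_1B.
have [||||] := card_bouquet (a := 0 : torus R L)
  (A := fun p => fixed_points R L (h p)) (s := primes m).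
- exact: primes_uniq.
- by move=> p pm; apply: finite_fixed_points (prime_mem _ pm) (Gh p) (oh _ pm) fpf.
- by move=> p _; apply: fix0.
- move=> p q pm qm pq x [/= xp xq].
  apply: (torsion_coprime (p := p) (q := q)).
  + by rewrite prime_coprime ?prime_mem// dvdn_prime2 ?prime_mem.
  + by apply: fixed_points_torsion (prime_mem _ pm) (Gh p) (oh _ pm) fpf _ xp.
  + by apply: fixed_points_torsion (prime_mem _ qm) (Gh q) (oh _ qm) fpf _ xq.
set U := [set x | _]%classic => finU cardU.
have -> : nonfree_points R L = U.
  apply/seteqP; split=> x; rewrite /nonfree_points /U /=.
  - move=> stab_x; right.
    have /existsP[s /andP[]] : [exists s, (s \in torus_stab x) && (s != 1%g)].
      apply: contraNT stab_x => /existsPn stab1; apply/eqP/setP => s.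
      rewrite !inE; apply/idP/eqP => [sx|->]; last by rewrite group1 torus_act1 eqxx.
      by apply/eqP; have := stab1 s; rewrite !inE sx => /negPn.
    rewrite !inE => /andP[Gs /eqP xs] s1.
    have s_gt1 : (1 < #[s]%g)%N by rewrite ltn_neqAle order_gt0 eq_sym order_eq1 s1.
    (* Any prime divisor of the order of [s] would do: a power of [s] then has order p and still
       fixes [x]. *)
    pose p := pdiv #[s]%g.
    have p_pr : prime p by exact: pdiv_prime.
    have ps : (p %| #[s]%g)%N by exact: pdiv_dvd.
    have pm : p \in primes m.
      by rewrite mem_primes p_pr m_gt0 -oG (dvdn_trans ps)// order_dvdG.
    exists p => //.
    have : fixed_points R L (s ^+ (#[s]%g %/ p))%g x by apply: fixed_points_expg.
    apply: fixed_points_cycle; first by rewrite groupX.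
    have os : #[(s ^+ (#[s]%g %/ p))%g]%g = p.
      by rewrite orderXdiv ?dvdn_div// divnA// mulKn// order_gt0.
    (* A cyclic group has at most one subgroup of each order. *)
    have /eqP-> : <[s ^+ (#[s] %/ p)]>%g == <[h p]>%g; last exact: cycle_id.
    by rewrite (eq_subG_cyclic cycG) ?cycle_subG ?groupX// -!orderE os oh.
  - have stab_neq1 s : s \in G -> s != 1%g -> torus_act x s = x -> torus_stab x != 1%g.
      move=> Gs s1 xs; apply: contraNneq s1 => stab1.
      have : s \in torus_stab x by rewrite inE Gs xs eqxx.
      by rewrite stab1 => /set1gP->.
    case=> [x0|[p pm xp]].
      (* The origin is non-free because [1 < m] makes the generator [g] nontrivial. *)
      apply: (stab_neq1 g) => //; last by rewrite x0; apply: fix0.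
      by rewrite -order_eq1 og gtn_eqF.
    apply: (stab_neq1 (h p)) => //.
    by rewrite -order_eq1 oh// gtn_eqF// prime_gt1// prime_mem.
split=> //; move: cardU => /(congr1 (fun k => k%:R : R)).
rewrite natrD => /(canRL (addrK _)) ->; rewrite natrD natr_sum addrAC.
congr (_ + _); rewrite big_seq [RHS]big_seq; apply: eq_bigr => p pm.
have p_pr := prime_mem _ pm; have p_gt1 := prime_gt1 p_pr.
have -> : p%:R - 1 = p.-1%:R :> R by rewrite -subn1 natrB// ltnW.
apply: natr_powR_root; first by rewrite -ltnS prednK// ltnW.
exact: card_fixed_points p_pr (Gh p) (oh _ pm) fpf.
Qed.
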